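(* Let $(X,\mathcal{A})$ be a measurable space and let $\mu\colon\mathcal{A}\to[0,\infty]$ be a nonadditive measure. Assume that $\mu$ has the pseudometric generating property (p.g.p.). If $X$ is countable, then the following assertions are equivalent. (i) $\mu$ has property (C). (ii) Any Cauchy in $\mu$-measure sequence $\{f_n\}_{n\in\mathbb{N}}\subset\mathcal{F}_0(X)$ has a subsequence converging $\mu$-almost uniformly. (iii) $\mu$ is null-continuous and any Cauchy in $\mu$-measure sequence $\{f_n\}_{n\in\mathbb{N}}\subset\mathcal{F}_0(X)$ has a subsequence converging in $\mu$-measure. (iv) $\mu$ is null-continuous and any Cauchy in $\mu$-measure sequence $\{f_n\}_{n\in\mathbb{N}}\subset\mathcal{F}_0(X)$ converges in $\mu$-measure.
   Context: $X$ is a nonempty set and $\mathcal{A}$ is a $\sigma$-field of subsets of $X$. A nonadditive measure is a set function $\mu\colon\mathcal{A}\to[0,\infty]$ with $\mu(\emptyset)=0$ and $\mu(A)\le\mu(B)$ whenever $A,B\in\mathcal{A}$, $A\subset B$. $\mathcal{F}_0(X)$ is the set of all $\mathcal{A}$-measurable functions $X\to\mathbb{R}$. Property (C): for any sequence $\{E_n\}_{n\in\mathbb{N}}\subset\mathcal{A}$, if $\sup_{l\in\mathbb{N}}\mu\left(\bigcup_{n=k}^{k+l}E_n\right)\to 0$ as $k\to\infty$, then $\mu\left(\bigcup_{n=k}^\infty E_n\right)\to 0$ as $k\to\infty$. (p.g.p.): $\mu(A_n\cup B_n)\to 0$ whenever $A_n,B_n\in\mathcal{A}$ and $\max\{\mu(A_n),\mu(B_n)\}\to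 0$. Null-continuous: $\mu(\bigcup_{n=1}^\infty N_n)=0$ whenever $\{N_n\}_{n\in\mathbb{N}}\subset\mathcal{A}$ is nondecreasing and $\mu(N_n)=0$ for every $n$. $\{f_n\}$ is Cauchy in $\mu$-measure if for any $\varepsilon>0$ and $\delta>0$ there is $n_0\in\mathbb{N}$ such that $\mu(\{|f_m-f_n|>\varepsilon\})<\delta$ whenever $m,n\ge n_0$. $\{f_n\}$ converges in $\mu$-measure to $f\in\mathcal{F}_0(X)$ if $\mu(\{|f_n-f|>\varepsilon\})\to 0$ for every $\varepsilon>0$. $\{f_n\}$ converges $\mu$-almost uniformly to $f\in\mathcal{F}_0(X)$ if for any $\varepsilon>0$ there is $E_\varepsilon\in\mathcal{A}$ with $\mu(E_\varepsilon)<\varepsilon$ such that $f_n\to f$ uniformly on $X\setminus E_\varepsilon$. A sequence is said to converge in one of these senses if it does so to some $f\in\mathcal{F}_0(X)$. *)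

(* Defs.v *)
From HB Require Import structures.
From mathcomp Require Import all_boot all_order all_algebra.
From mathcomp Require Import all_classical all_reals all_analysis.
Import Order.TTheory GRing.Theory Num.Theory.
Import numFieldNormedType.Exports.

Set Implicit Arguments.
Unset Strict Implicit.
Unset Printing Implicit Defensive.

Local Open Scope classical_set_scope.
Local Open Scope ring_scope.
Local Open Scope ereal_scope.

(* A nonadditive measure is represented by a total function on [set X], of which
   only the values on measurable sets are ever constrained or used. *)
Definition nonadditive_measure (R : realType) (d : measure_display)
    (X : measurableType d) (mu : set X -> \bar R) : Prop :=
  [/\ mu set0 = 0,
      (forall A, measurable A -> 0 <= mu A) &
      (forall A B, measurable A -> measurable B -> A `<=` B -> mu A <= mu B)].

Definition property_C (R : realType) (d : measure_display)
    (X : measurableType d) (mu : set X -> \bar R) : Prop :=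
  forall E : (set X)^nat, (forall n, measurable (E n)) ->
    ereal_sup (range (fun l : nat =>
      mu (\bigcup_(n in [set n | (k <= n <= k + l)%N]) E n))) @[k --> \oo] --> 0 ->
    mu (\bigcup_(n in [set n | (k <= n)%N]) E n) @[k --> \oo] --> 0.

Definition pgp (R : realType) (d : measure_display)
    (X : measurableType d) (mu : set X -> \bar R) : Prop :=
  forall A B : (set X)^nat,
    (forall n, measurable (A n)) -> (forall n, measurable (B n)) ->
    maxe (mu (A n)) (mu (B n)) @[n --> \oo] --> 0 ->
    mu (A n `|` B n) @[n --> \oo] --> 0.

Definition null_continuous (R : realType) (d : measure_display)
    (X : measurableType d) (mu : set X -> \bar R) : Prop :=
  forall N : (set X)^nat, (forall n, measurable (N n)) ->
    {homo N : m n / (m <= n)%N >-> m `<=` n} ->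
    (forall n, mu (N n) = 0) -> mu (\bigcup_n N n) = 0.

Definition cauchy_in_measure (R : realType) (d : measure_display)
    (X : measurableType d) (mu : set X -> \bar R) (f : (X -> R)^nat) : Prop :=
  forall eps delta : R, (0 < eps)%R -> (0 < delta)%R ->
    exists n0 : nat, forall m n : nat, (n0 <= m)%N -> (n0 <= n)%N ->
      mu [set x | (eps < `|f m x - f n x|)%R] < delta%:E.

Definition converges_in_measure (R : realType) (d : measure_display)
    (X : measurableType d) (mu : set X -> \bar R) (f : (X -> R)^nat) : Prop :=
  exists2 g : X -> R, measurable_fun [set: X] g &
    forall eps : R, (0 < eps)%R ->
      mu [set x | (eps < `|f n x - g x|)%R] @[n --> \oo] --> 0.

Definition converges_almost_uniformly (R : realType) (d : measure_display)
    (X : measurableType d) (mu : set X -> \bar R) (f : (X -> R)^nat) : Prop :=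
  exists2 g : X -> R, measurable_fun [set: X] g &
    forall eps : R, (0 < eps)%R ->
      exists E : set X, [/\ measurable E, mu E < eps%:E &
        {uniform ~` E, f @ \oo --> g}].

Definition has_subsequence (T : Type) (P : T^nat -> Prop) (u : T^nat) : Prop :=
  exists2 phi : nat -> nat, {homo phi : m n / (m < n)%N} & P (u \o phi).

(* [P] holds for every sequence of real measurable functions that is Cauchy in
   [mu]-measure. *)
Definition every_cauchy_in_measure (R : realType) (d : measure_display)
    (X : measurableType d) (mu : set X -> \bar R)
    (P : (X -> R)^nat -> Prop) : Prop :=
  forall f : (X -> R)^nat, (forall n, measurable_fun [set: X] (f n)) ->
    cauchy_in_measure mu f -> P f.

(* Main.v *)
(* (i) => (ii): (p.g.p.) gives scales d_0 >= d_1 >= ... -> 0 such that sets E_n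
   with mu (E_n) < d_(n+1) have all their finite unions from index k on of
   measure < d_k.  Taking E_n = {|f_n - f_(n+1)| > 2^-n} along a fast
   subsequence, property (C) bounds the infinite tails, off which the
   subsequence is uniformly Cauchy.
   (ii) => (iii): for null sets N_n increasing to N, the sequence n 1_(N_n) is
   Cauchy in measure but diverges at every point of N, so N lies in every
   exceptional set of almost uniform convergence.
   (iv) => (i): f_n = sum_(k < n) 1_(E_k) is Cauchy in measure; let g be its
   limit.  The sets C_M of points with |f_m - g| > 1/4 for all m >= M are null
   and increase to a null set Z.  If x lies in E_k with k >= n but not in Z,
   then some f_m x >= f_n x + 1 is within 1/4 of g x, so |f_n x - g x| > 1/2.
   Hence the tail union from n on lies in Z U {|f_n - g| > 1/2}. *)
Require Import Defs.
From mathcomp Require Import all_boot all_order all_algebra.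
From mathcomp Require Import all_classical all_reals all_analysis.
From mathcomp Require Import measurable_realfun lra.
Import Order.TTheory GRing.Theory Num.Theory.
Import numFieldNormedType.Exports.

Set Implicit Arguments.
Unset Strict Implicit.
Unset Printing Implicit Defensive.

Local Open Scope classical_set_scope.
Local Open Scope ring_scope.

(** * Convergence criteria and geometric telescoping *)

Lemma cvge0_lt (R : realType) (u : (\bar R)^nat) :
  u n @[n --> \oo] --> 0%E ->
  forall e : R, 0 < e -> \forall n \near \oo, (u n < e%:E)%E.
Proof.
move=> u_0 e e0; apply: (u_0 [set y | (y < e%:E)%E]); rewrite /nbhs/= /nbhs /=.
exists e => //= y; rewrite /ball_/= sub0r normrN lte_fin.
exact/le_lt_trans/ler_norm.
Qed.

Lemma ge0_lt_cvge0 (R : realType) (u : (\bar R)^nat) :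
  (forall n, (0 <= u n)%E) ->
  (forall e : R, 0 < e -> \forall n \near \oo, (u n < e%:E)%E) ->
  u n @[n --> \oo] --> 0%E.
Proof.
move=> u0 ulte A [e /= e0 eA]; apply: filterS (ulte _ e0) => n.
rewrite /=; have := u0 n; case: (u n) => //= r; rewrite lee_fin lte_fin => r0 re.
by apply: eA; rewrite /ball_/= sub0r normrN ger0_norm.
Qed.

Lemma uniform_cvgP (R : realType) (T : choiceType) (A : set T)
    (f : (T -> R)^nat) (g : T -> R) :
  {uniform A, f @ \oo --> g} <->
  forall e : R, 0 < e -> \forall n \near \oo, forall x, A x -> `|g x - f n x| < e.
Proof.
split=> [fg e e0|fg P /uniform_nbhs[E [entE EP]]].
  apply: (fg [set h | forall x, A x -> `|g x - h x| < e]).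
  apply/uniform_nbhs; exists [set xy | ball xy.1 e xy.2]; split => //.
  exact: (entourage_ball _ (PosNum e0)).
move: entE; rewrite -entourage_ballE => -[e /= e0 eE].
apply: filterS (fg _ e0) => n fgn; apply: EP => x /= Ax.
by apply: eE => /=; exact: fgn.
Qed.

Lemma telescope_half (R : realType) (u : R^nat) (k : nat) :
  (forall n, (k <= n)%N -> `|u n - u n.+1| <= 2^-1 ^+ n) ->
  forall m n, (k <= m)%N -> (m <= n)%N -> `|u m - u n| <= 2 * 2^-1 ^+ m.
Proof.
move=> uk m n km /subnKC <-.
(* The bound is strengthened to the exact geometric sum of [2^-1 ^+ i] for [i] from [m] to [n - 1],
   so that the induction closes. *)
suff : `|u m - u (m + (n - m))%N| <=
    2 * 2^-1 ^+ m - 2 * 2^-1 ^+ (m + (n - m)) :> R.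
  move/le_trans; apply; rewrite gerBl.
  by rewrite mulr_ge0// exprn_ge0.
elim: (n - m)%N => [|l IH]; first by rewrite addn0 !subrr normr0.
rewrite addnS exprS.
have := uk (m + l)%N (leq_trans km (leq_addr _ _)).
have := ler_distD (u (m + l)%N) (u m) (u (m + l).+1).
lra.
Qed.

Lemma half_expn_lt (R : realType) (e : R) : 0 < e ->
  \forall n \near \oo, 2 * 2^-1 ^+ n < e.
Proof.
move=> e0; have e20 : 0 < e / 2 by rewrite divr_gt0.
apply: filterS (near_infty_natSinv_expn_lt (PosNum e20)) => n /=.
by rewrite exprVn mul1r; lra.
Qed.

(** The bound of [telescope_half] makes [u] Cauchy and survives letting [n] tend to infinity. Used
    pointwise on functions, it gives a rate independent of the point, hence uniform convergence. *)
Lemma telescope_half_cvg (R : realType) (u : R^nat) (k : nat) :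
  (forall n, (k <= n)%N -> `|u n - u n.+1| <= 2^-1 ^+ n) ->
  cvg (u @ \oo) /\
  forall m, (k <= m)%N -> `|u m - limn u| <= 2 * 2^-1 ^+ m.
Proof.
move=> /telescope_half uk.
have cu : cvg (u @ \oo).
  apply/cauchy_cvgP/cauchy_exP => e e0.
  have [m _ /(_ _ (leq_maxr k m))/= me] := half_expn_lt e0.
  exists (u (maxn k m)), (maxn k m) => // n /= mn.
  exact: le_lt_trans (uk _ _ (leq_maxl _ _) mn) me.
split=> // m km.
have umn : `|u m - u n| @[n --> \oo] --> `|u m - limn u|.
  by apply: cvg_norm; apply: cvgB cu; exact: cvg_cst.
rewrite -(cvg_lim _ umn)//; apply: limr_le; first by apply/cvg_ex; eexists; exact: umn.
by exists m => // n /= mn; exact: uk.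
Qed.

Section nonadditive_measure_theory.
Context (R : realType) (d : measure_display) (X : measurableType d).
Variable mu : set X -> \bar R.
Hypothesis hmu : nonadditive_measure mu.

Let mu_ge0 A : measurable A -> (0 <= mu A)%E.
Proof. by case: hmu => _ + _; exact. Qed.

Let le_mu A B : measurable A -> measurable B -> A `<=` B -> (mu A <= mu B)%E.
Proof. by case: hmu => _ _; exact. Qed.

Lemma measurable_dist_gt (f g : X -> R) (e : R) :
  measurable_fun setT f -> measurable_fun setT g ->
  measurable [set x | e < `|f x - g x|].
Proof.
move=> mf mg; rewrite -[X in measurable X]setTI.
have := measurable_fun_ltr (measurable_cst e)
  (measurableT_comp (@normr_measurable R setT) (measurable_funB mf mg)).
by move=> /(_ measurableT [set true]); exact.
Qed.

(** * Quantitative forms of (p.g.p.) *)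

(** If every [t] failed, failing pairs for [t = 1/(n+1)] would form two sequences with measures
    tending to 0 whose unions keep measure at least [e], against (p.g.p.). *)
Lemma pgp_uniform : pgp mu -> forall e : R, 0 < e ->
  exists2 t : R, 0 < t & forall A B, measurable A -> measurable B ->
    (mu A < t%:E -> mu B < t%:E -> mu (A `|` B) < e%:E)%E.
Proof.
move=> hpgp e e0; apply: contrapT => /forall2NP H.
have {}H n : exists AB : set X * set X,
    [/\ measurable AB.1, measurable AB.2, (mu AB.1 < n.+1%:R^-1%:E)%E,
      (mu AB.2 < n.+1%:R^-1%:E)%E & (e%:E <= mu (AB.1 `|` AB.2))%E].
  have [|nH] := H n.+1%:R^-1; first by rewrite invr_gt0 ltr0n.
  apply: contrapT => /forallNP K; apply: nH => A B mA mB Ae Be.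
  rewrite ltNge; apply/negP => eAB.
  by apply: (K (A, B)); split.
have [AB {}H] := choice H.
have mA n : measurable (AB n).1 by case: (H n).
have mB n : measurable (AB n).2 by case: (H n).
have : mu ((AB n).1 `|` (AB n).2) @[n --> \oo] --> 0%E.
  apply: hpgp => //; apply: ge0_lt_cvge0 => [n|t t0].
    by rewrite le_max mu_ge0.
  apply: filterS (near_infty_natSinv_lt (PosNum t0)) => n /= nt.
  have [_ _ An Bn _] := H n.
  by rewrite gt_max (lt_trans An) ?(lt_trans Bn) ?lte_fin.
move=> /cvge0_lt/(_ e e0)[n _ /(_ n (leqnn n))/=].
by have [_ _ _ _] := H n; rewrite leNgt => /negP.
Qed.

(** Each scale is so small that two sets below [dl k.+1] have a union below [dl k]. A block of sets
    is its first set joined to a shorter block starting at [k.+1], both below [dl k.+1], so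
    induction on the length applies. *)
Lemma pgp_scale : pgp mu -> exists dl : R^nat,
  [/\ forall k, 0 < dl k, forall k, dl k <= k.+1%:R^-1 &
   forall E : (set X)^nat, (forall n, measurable (E n)) ->
     (forall n, (mu (E n) < (dl n.+1)%:E)%E) ->
   forall k l, (mu (\bigcup_(n in [set n | (k <= n <= k + l)%N]) E n)
     < (dl k)%:E)%E].
Proof.
move=> /pgp_uniform hpgp.
(* The premise [0 < e] sits inside the existential so that choice yields a total [g]; for
   nonpositive [e] the witness 0 will do. *)
have /choice[g gP] (e : R) : exists t : R, 0 < e -> 0 < t /\
    forall A B, measurable A -> measurable B ->
    (mu A < t%:E -> mu B < t%:E -> mu (A `|` B) < e%:E)%E.
  by have [/hpgp[t t0 tP]|_] := ltP 0 e; [exists t|exists 0].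
(* Of the three terms, [g (dl k')] controls unions, [dl k'] makes the scale nonincreasing, and
   [1/(k'+2)] forces it to 0. *)
pose dl := fix dl k :=
  if k is k'.+1 then Num.min (Num.min (g (dl k')) (dl k')) k'.+2%:R^-1 else 1.
have dl0 k : 0 < dl k.
  by elim: k => //= k IH; rewrite !lt_min IH invr_gt0 ltr0n; case: (gP _ IH) => ->.
have dlg k : dl k.+1 <= g (dl k) by rewrite /= !ge_min lexx.
have dlS k : dl k.+1 <= dl k by rewrite /= !ge_min lexx orbT.
exists dl; split=> // [[|k]|E mE Edl k l].
- by rewrite invr1.
- by rewrite /= ge_min lexx orbT.
have mU a b : measurable (\bigcup_(n in [set n | (a <= n <= b)%N]) E n).
  by apply: bigcup_measurable.
elim: l k => [|l IH] k.
  rewrite addn0 (_ : [set n | (k <= n <= k)%N] = [set k]).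
    by rewrite bigcup_set1 (lt_le_trans (Edl k)) ?lee_fin.
  by apply/seteqP; split=> n /=; [rewrite -eqn_leq => /eqP|move=> ->; rewrite leqnn].
rewrite (_ : \bigcup_(n in _) E n =
    E k `|` \bigcup_(n in [set n | (k.+1 <= n <= k.+1 + l)%N]) E n); last first.
  rewrite addSnnS -(bigcup_set1 E k) -bigcup_setU; congr bigcup.
  apply/seteqP; split=> n /=.
    by rewrite leq_eqVlt => /andP[/orP[/eqP ->|-> ->]]; [left|right].
  by case=> [->|/andP[/ltnW -> //]]; rewrite leqnn leq_addr.
have [_] := gP _ (dl0 k); apply=> //.
- by rewrite (lt_le_trans (Edl k)) ?lee_fin.
- by rewrite (lt_le_trans (IH k.+1)) ?lee_fin.
Qed.

(** * From property (C) to almost uniformly convergent subsequences *)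

Lemma cauchy_in_measure_fast_subsequence (f : (X -> R)^nat) (e t : R^nat) :
  cauchy_in_measure mu f -> (forall k, 0 < e k) -> (forall k, 0 < t k) ->
  exists2 phi : nat -> nat, {homo phi : m n / (m < n)%N} &
  forall k, (mu [set x | (e k < `|f (phi k) x - f (phi k.+1) x|)%R] < (t k)%:E)%E.
Proof.
move=> cf e0 t0.
have /choice[N NP] := fun k => cf _ _ (e0 k) (t0 k).
(* These partial sums increase strictly and dominate [N k], even when [N] is not monotone. *)
pose phi k := (\sum_(i < k.+1) (N i).+1)%N.
have phiN k : (N k <= phi k)%N.
  by rewrite /phi big_ord_recr/= addnS ltnW// ltnS leq_addl.
have phiS k : (phi k < phi k.+1)%N.
  by rewrite /phi [ltnRHS]big_ord_recr/= addnS ltnS leq_addr.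
exists phi; first exact: homo_ltn ltn_trans phiS.
by move=> k; apply: NP => //; rewrite (leq_trans (phiN k))// ltnW.
Qed.

Lemma property_C_almost_uniformly : pgp mu -> property_C mu ->
  every_cauchy_in_measure mu
    (has_subsequence (converges_almost_uniformly mu)).
Proof.
move=> /pgp_scale[dl [dl0 dlV dlE]] hC f mf cf.
have half0 k : 0 < 2^-1 ^+ k :> R by rewrite exprn_gt0.
have [phi phi_incr phiE] :=
  cauchy_in_measure_fast_subsequence cf half0 (fun k => dl0 k.+1).
exists phi => //; set h := f \o phi.
have mh n : measurable_fun setT (h n) by exact: mf.
pose E k := [set x | 2^-1 ^+ k < `|h k x - h k.+1 x|].
have mE k : measurable (E k) by exact: measurable_dist_gt.
pose F k := \bigcup_(n in [set n | (k <= n)%N]) E n.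
have mF k : measurable (F k) by exact: bigcup_measurable.
have hF k x : ~ F k x -> forall n, (k <= n)%N ->
    `|h n x - h n.+1 x| <= 2^-1 ^+ n.
  by move=> Fx n kn; rewrite leNgt; apply/negP => En; apply: Fx; exists n.
(* Finite unions from [k] on have measure below [dl k <= 1/(k+1)], so their supremum tends to 0 and
   property (C) passes to the infinite unions. *)
have muF : mu (F k) @[k --> \oo] --> 0%E.
  apply: hC => //; apply: ge0_lt_cvge0 => [k|e e0].
    apply: le_trans (ereal_sup_ubound _); last by exists 0%N.
    exact/mu_ge0/bigcup_measurable.
  apply: filterS (near_infty_natSinv_lt (PosNum e0)) => k /= ke.
  apply: le_lt_trans (_ : _ <= (dl k)%:E)%E _.
    by apply: ge_ereal_sup => _ [l _ <-]; exact/ltW/dlE.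
  by rewrite lte_fin (le_lt_trans (dlV k)).
(* Only on [L] may [h] diverge. Setting it to 0 there yields a measurable limit defined everywhere;
   since [L] lies in every [F k], nothing changes off [F k]. *)
pose L := \bigcap_k F k.
have mL : measurable L by exact: bigcapT_measurable.
pose h' n x := h n x * \1_(~` L) x.
exists (fun x => limn (h' ^~ x)).
  apply: (measurable_fun_cvg (h := h')) => [n|x _].
    by apply: measurable_funM => //; exact/measurable_indic/measurableC.
  have [Lx|nLx] := pselect (L x).
    have -> : h' ^~ x = cst 0.
      by apply/funext => n; rewrite /h' indicE memNset ?mulr0.
    by rewrite lim_cst//; exact: cvg_cst.
  have -> : h' ^~ x = h ^~ x.
    by apply/funext => n; rewrite /h' indicE mem_set// mulr1.
  have /existsNP[k /not_implyP[_ Fk]] := nLx.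
  by have [] := telescope_half_cvg (hF _ _ Fk).
move=> e e0.
have [k _ /(_ k (leqnn k))/= ke] := cvge0_lt muF e0.
exists (F k); split => //.
apply/uniform_cvgP => t t0.
near=> n => x Fx.
have -> : h' ^~ x = h ^~ x.
  by apply/funext => m; rewrite /h' indicE mem_set ?mulr1// => /(_ k I).
rewrite distrC (le_lt_trans ((telescope_half_cvg (hF _ _ Fx)).2 n _))//; near: n.
- exact: nbhs_infty_ge.
- exact: half_expn_lt.
Unshelve. all: by end_near. Qed.

(** * Null-continuity and convergence in measure *)

Lemma almost_uniformly_null_continuous :
  every_cauchy_in_measure mu
    (has_subsequence (converges_almost_uniformly mu)) -> null_continuous mu.
Proof.
move=> hau N mN ndN N0; have mUN := bigcupT_measurable N mN.
pose f n x : R := n%:R * \1_(N n) x.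
have mf n : measurable_fun setT (f n).
  by apply: measurable_funM => //; exact: measurable_indic.
have cf : cauchy_in_measure mu f.
  move=> e t e0 t0; exists 0%N => m n _ _.
  (* Both [f m] and [f n] vanish off the null set [N (maxn m n)]. *)
  rewrite (le_lt_trans (le_mu _ (mN (maxn m n)) _)) ?N0//.
    exact: measurable_dist_gt.
  move=> x /=; rewrite /f !indicE; apply: contraPP => Nx.
  rewrite !memNset ?mulr0 ?subrr ?normr0; first by apply/negP; rewrite -leNgt ltW.
  - by move=> Nnx; apply: Nx; exact: ndN (leq_maxr _ _) _ Nnx.
  - by move=> Nmx; apply: Nx; exact: ndN (leq_maxl _ _) _ Nmx.
have [phi phi_incr [g mg fg]] := hau f mf cf.
have phi_ge n : (n <= phi n)%N.
  by elim: n => // n IH; rewrite (leq_ltn_trans IH)// phi_incr.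
have UN_lt (e : R) : 0 < e -> (mu (\bigcup_n N n) < e%:E)%E.
  move=> /fg[E [mE Ee /uniform_cvgP fgE]].
  apply: le_lt_trans Ee; apply: le_mu => // x [k _ Nkx].
  apply: contrapT => Ex.
  have [m _ mfg] := fgE _ ltr01.
  (* Here [x] is in [N k] but not in [E]. This [n] is past the threshold [m] for closeness within 1,
     past [k], so that [f (phi n) x] is [phi n], and above [g x + 1]: a contradiction, as
     [phi n >= n]. *)
  pose n := maxn (maxn m k) (Num.bound `|g x + 1|).
  have /mfg /(_ x Ex) : (m <= n)%N by rewrite /n -maxnA leq_maxl.
  have kn : (k <= n)%N by rewrite /n maxnAC leq_maxr.
  rewrite /= /f indicE mem_set ?mulr1; last first.
    exact: ndN (leq_trans kn (phi_ge n)) _ Nkx.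
  rewrite ltr_norml => /andP[+ _].
  have gn : g x + 1 < n%:R.
    apply: le_lt_trans (ler_norm _) _.
    by rewrite (lt_le_trans (archi_boundP (normr_ge0 _)))// ler_nat leq_maxr.
  have : (n%:R : R) <= (phi n)%:R by rewrite ler_nat.
  lra.
apply/eqP; rewrite eq_le mu_ge0// andbT.
by apply/lee_addgt0Pr => e /UN_lt/ltW; rewrite add0e.
Qed.

Lemma almost_uniformly_in_measure (f : (X -> R)^nat) :
  (forall n, measurable_fun setT (f n)) ->
  converges_almost_uniformly mu f -> converges_in_measure mu f.
Proof.
move=> mf [g mg fg]; exists g => // e e0.
have mfg n : measurable [set x | e < `|f n x - g x|] by exact: measurable_dist_gt.
apply: ge0_lt_cvge0 => [n|t /fg[E [mE Et /uniform_cvgP/(_ _ e0)]]]; first exact: mu_ge0.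
apply: filterS => n fgn.
apply: le_lt_trans Et; apply: le_mu => // x /=.
by apply: contraPP => /fgn; rewrite distrC => /ltW; rewrite leNgt => /negP.
Qed.

(** By the triangle inequality [|f_n - g| > e] forces [|f_n - f_(phi n)| > e/2] or
    [|f_(phi n) - g| > e/2]. The first set is small by the Cauchy property, as [phi n >= n], the
    second by convergence of the subsequence, and (p.g.p.) joins them. *)
Lemma cauchy_subsequence_in_measure (f : (X -> R)^nat) : pgp mu ->
  (forall n, measurable_fun setT (f n)) -> cauchy_in_measure mu f ->
  has_subsequence (converges_in_measure mu) f -> converges_in_measure mu f.
Proof.
move=> hpgp mf cf [phi phi_incr [g mg fg]]; exists g => // e e0.
have phi_ge n : (n <= phi n)%N.
  by elim: n => // n IH; rewrite (leq_ltn_trans IH)// phi_incr.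
have e20 : 0 < e / 2 by rewrite divr_gt0.
pose A n := [set x | e / 2 < `|f n x - f (phi n) x|].
pose B n := [set x | e / 2 < `|f (phi n) x - g x|].
have mA n : measurable (A n) by exact: measurable_dist_gt.
have mB n : measurable (B n) by exact: measurable_dist_gt.
have AB : mu (A n `|` B n) @[n --> \oo] --> 0%E.
  apply: hpgp => //; apply: ge0_lt_cvge0 => [n|t t0]; first by rewrite le_max mu_ge0.
  have [n0 n0P] := cf _ _ e20 t0.
  have [n1 _ n1P] := cvge0_lt (fg _ e20) t0.
  exists (maxn n0 n1) => // n /=; rewrite geq_max => /andP[n0n n1n].
  rewrite gt_max n0P ?n1P//; exact: leq_trans n0n (phi_ge n).
have mfg n : measurable [set x | e < `|f n x - g x|] by exact: measurable_dist_gt.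
apply: ge0_lt_cvge0 => [n|t t0]; first exact: mu_ge0.
apply: filterS (cvge0_lt AB t0) => n; apply: le_lt_trans; apply: le_mu => //.
  exact: measurableU.
move=> x /= ex; rewrite /A /B /=.
have [|le] := ltP (e / 2) `|f n x - f (phi n) x|; [by left|right].
have := ler_distD (f (phi n) x) (f n x) (g x).
lra.
Qed.

(** * Recovering property (C) *)

Lemma in_measure_property_C : pgp mu -> null_continuous mu ->
  every_cauchy_in_measure mu (converges_in_measure mu) -> property_C mu.
Proof.
move=> hpgp hnc hcv E mE.
have mEI (I : set nat) : measurable (\bigcup_(n in I) E n).
  exact: bigcup_measurable.
have mu_sup k l : (mu (\bigcup_(n in [set n | (k <= n <= k + l)%N]) E n) <=
    ereal_sup (range (fun l =>
      mu (\bigcup_(n in [set n | (k <= n <= k + l)%N]) E n))))%E.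
  by apply: ereal_sup_ubound; exists l.
move=> /cvge0_lt supE.
pose f n x : R := \sum_(k < n) \1_(E k) x.
have mf n : measurable_fun setT (f n).
  by apply: measurable_sum => i; exact: measurable_indic.
have f_nd x m n : (m <= n)%N -> f m x <= f n x.
  move=> /subnKC <-; rewrite /f big_split_ord/= lerDl; apply: sumr_ge0 => i _.
  by rewrite indicE ler0n.
have f_jump x n m k : E k x -> (n <= k < m)%N -> f n x + 1 <= f m x.
  move=> Ekx /andP[nk km]; apply: le_trans (f_nd x _ _ km).
  by rewrite /f big_ord_recr/= indicE mem_set//= lerD2r; exact: f_nd.
have f_eq x m n : (m <= n)%N ->
    (forall k, (m <= k < n)%N -> ~ E k x) -> f m x = f n x.
  move=> /subnKC <-; elim: (n - m)%N => [|l IH] Ex; first by rewrite addn0.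
  rewrite addnS {2}/f big_ord_recr/= -/(f _ _) IH.
    by rewrite indicE memNset ?addr0//; apply: Ex; rewrite leq_addr addnS /=.
  by move=> k /andP[mk kl]; apply: Ex; rewrite mk addnS ltnS ltnW.
have cf : cauchy_in_measure mu f.
  move=> e t e0 t0.
  have [n0 _ n0P] := supE _ t0; exists n0.
  suff H m n : (n0 <= m)%N -> (m <= n)%N ->
      (mu [set x | (e < `|f m x - f n x|)%R] < t%:E)%E.
    move=> m n n0m n0n; have [/H-/(_ n0m)//|/ltnW/H-/(_ n0n)] := leqP m n.
    by under eq_set do rewrite distrC.
  move=> n0m mn.
  (* [f m] and [f n] differ only on sets [E k] with [m <= k < n]; the block from [n0] to [n0 + n]
     generously contains these indices. *)
  apply: le_lt_trans (n0P n0 (leqnn _)); apply: le_trans (mu_sup n0 n).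
  apply: le_mu => //; first exact: measurable_dist_gt.
  move=> x /=; apply: contraPP => Ex.
  rewrite (f_eq x m n mn) ?subrr ?normr0; first by apply/negP; rewrite -leNgt ltW.
  move=> k /andP[mk kn] Ekx; apply: Ex; exists k => //=.
  by rewrite (leq_trans n0m mk)/= (leq_trans (ltnW kn))// leq_addl.
have [g mg fg] := hcv f mf cf.
have mfg e n : measurable [set x | e < `|f n x - g x|] by exact: measurable_dist_gt.
pose C M := \bigcap_(m in [set m | (M <= m)%N]) [set x | 4^-1 < `|f m x - g x|].
have mC M : measurable (C M) by exact: bigcap_measurableType.
pose Z := \bigcup_M C M.
have mZ : measurable Z by exact: bigcupT_measurable.
have quarter0 : 0 < 4^-1 :> R by rewrite invr_gt0.
have muZ : mu Z = 0%E.
  (* [C M] lies in [{|f_m - g| > 1/4}] for every [m >= M], and these measures tend to 0. *)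
  apply: hnc => // [m n mn x Cmx k /= nk|M]; first exact/Cmx/(leq_trans mn).
  apply/eqP; rewrite eq_le mu_ge0// andbT.
  apply/lee_addgt0Pr => e e0; rewrite add0e.
  have [n _ nP] := cvge0_lt (fg _ quarter0) e0.
  apply: le_trans (ltW (nP (maxn n M) (leq_maxl _ _))).
  by apply: le_mu => // x; apply; exact: leq_maxr.
have ZB : mu (Z `|` [set x | 2^-1 < `|f n x - g x|]) @[n --> \oo] --> 0%E.
  (* (p.g.p.) with a constant null sequence: joining [Z] preserves convergence of the measures to
     0. *)
  apply: (hpgp (fun=> Z)) => //; under eq_fun do rewrite muZ (max_idPr (mu_ge0 (mfg _ _))).
  exact: fg.
apply: ge0_lt_cvge0 => [n|e e0]; first exact: mu_ge0.
apply: filterS (cvge0_lt ZB e0) => n.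
apply: le_lt_trans; apply: le_mu => //; first exact: measurableU.
move=> x [k /= nk Ekx].
have [Zx|nZx] := pselect (Z x); [by left|right].
(* Using [C k.+1] rather than [C k] gives [m > k], so that [f m x] counts the jump at [k]; then
   [g x - f n x >= 1 - 1/4 > 1/2]. *)
have /existsNP[m /not_implyP[/= km]] : ~ C k.+1 x by move=> Cx; apply: nZx; exists k.+1.
move=> /negP; rewrite -leNgt => fgm.
have := @f_jump x n m k Ekx; rewrite nk => /(_ km).
move: fgm; rewrite ler_norml => /andP[fgm1 fgm2] fnm.
by rewrite distrC ltr_normr; apply/orP; left; lra.
Qed.

End nonadditive_measure_theory.

Theorem theorem4p5 (R : realType) (d : measure_display) (X : measurableType d)
    (mu : set X -> \bar R)
    (hmu : nonadditive_measure mu)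
    (hpgp : pgp mu)
    (hcount : countable [set: X]) :
  [<-> property_C mu;
       every_cauchy_in_measure mu
         (has_subsequence (converges_almost_uniformly mu));
       null_continuous mu /\
       every_cauchy_in_measure mu (has_subsequence (converges_in_measure mu));
       null_continuous mu /\
       every_cauchy_in_measure mu (converges_in_measure mu)].
Proof.
tfae.
- exact: property_C_almost_uniformly.
- move=> hau; split; first exact: almost_uniformly_null_continuous.
  move=> f mf /(hau f mf)[phi phi_incr fau]; exists phi => //.
  by apply: almost_uniformly_in_measure fau => // n; exact: mf.
- move=> [hnc hsub]; split=> // f mf cf.
  by apply: cauchy_subsequence_in_measure => //; exact: hsub.
- by move=> [hnc hcv]; exact: in_measure_property_C.
Qed.
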